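(* Let $R>0$, $0<\theta_1<\theta_0<\pi$, $\Delta=\{z\in\mathbb{C}: |z|>R,\ |\arg z|<\theta_0\}$ and $\Delta'=\Delta\cap\{z:|\arg z|\le\theta_1\}$. Let $\{g_n\}_{n\ge 0}\in GAS(\theta_0,\theta_1,R)$, i.e. $\{g_n\}$ is a good asymptotic sequence on $\Delta'$. Then $\{g_n'\}_{n\ge0}$ is an asymptotic sequence as $z\to\infty$ in $\Delta'$. Furthermore, if $f$ and $f_n$ ($n\ge 0$) are analytic functions on $\Delta$ such that $$f(z)\sim\sum_{n=0}^{\infty}f_n(z),\qquad \{g_n\},\qquad z\to\infty \text{ in } \Delta,$$ then $$f'(z)\sim\sum_{n=0}^{\infty}f_n'(z),\qquad \{g_n'\},\qquad z\to\infty \text{ in } \Delta'.$$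
   Context: For a set $S\subset\mathbb{C}$ and functions $a,b$ on $S$, $a(z)=o(b(z))$ as $z\to\infty$ in $S$ means: for every $\epsilon>0$ there is $R_0$ such that $|a(z)|\le\epsilon|b(z)|$ for all $z\in S$ with $|z|\ge R_0$. A sequence of functions $\{g_n\}_{n\ge0}$ is an asymptotic sequence as $z\to\infty$ in $S$ if $g_{n+1}=o(g_n)$ as $z\to\infty$ in $S$ for every $n\ge0$. The notation $f(z)\sim\sum_{n=0}^\infty f_n(z),\ \{g_n\},\ z\to\infty$ in $S$, means that for every $N\ge0$, $f(z)-\sum_{n=0}^N f_n(z)=o(g_N(z))$ as $z\to\infty$ in $S$. Good test function: $GTF(\theta_0,\theta_1,R)$ is the class of analytic functions $g$ on $\Delta$ for which there exist constants $C>0$ and $R_1>R$ such that for every $z\in\Delta'$ with $|z|\ge R_1$ there exists $R(z)\in(0,\tfrac12|z|]$ such that the circle $C_z=\{\xi:|\xi-z|=R(z)\}$ is contained in $\Delta$ and $$\int_{C_z}\frac{|g(\xi)|}{|\xi-z|^2}\,|d\xi|\le C|g'(z)|.$$ Good asymptotic sequence: $GAS(\theta_0,\theta_1,R)$ is the class of asymptotic sequences $\{g_n\}_{n\ge 0}$ as $z\to\infty$ in $\Delta$ such that $g_n\in GTF(\theta_0,\theta_1,R)$ for every $n$. *)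

(* Defs.v *)
From Stdlib Require Import Reals Lra.
From Coquelicot Require Import Coquelicot.
Open Scope R_scope.

(* Principal argument; [Carg_spec] shows that it lies in (-PI, PI]. *)
Definition Carg (z : C) : R :=
  if Rle_dec 0 (Im z) then acos (Re z / Cmod z) else - acos (Re z / Cmod z).

Lemma Carg_spec (z : C) (hz : z <> 0%C) :
  - PI < Carg z <= PI /\ z = (Cmod z * cos (Carg z), Cmod z * sin (Carg z)).
Proof.
  assert (Hm : 0 < Cmod z) by now apply Cmod_gt_0.
  assert (H2 : Re z * Re z + Im z * Im z = Cmod z * Cmod z).
  { generalize (Cmod2_alt z); simpl; lra. }
  set (x := Re z / Cmod z); set (y := Im z / Cmod z).
  assert (Hx : Cmod z * x = Re z) by (unfold x; field; lra).
  assert (Hy : Cmod z * y = Im z) by (unfold y; field; lra).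
  assert (Hxy : x * x + y * y = 1).
  { unfold x, y; replace (Re z / Cmod z * (Re z / Cmod z)
      + Im z / Cmod z * (Im z / Cmod z))
      with ((Re z * Re z + Im z * Im z) / (Cmod z * Cmod z)) by (field; lra).
    rewrite H2; field; lra. }
  assert (Hb : -1 <= x <= 1) by nra.
  assert (Hs : sin (acos x) = Rabs y).
  { rewrite sin_acos by exact Hb.
    replace (1 - Rsqr x) with (Rsqr y) by (unfold Rsqr; lra).
    apply sqrt_Rsqr_abs. }
  assert (HPI := PI_RGT_0).
  assert (Ha := acos_bound x).
  unfold Carg; fold x.
  destruct (Rle_dec 0 (Im z)) as [Hi|Hi].
  - assert (0 <= y) by nra.
    split; [lra|].
    rewrite cos_acos, Hs, Rabs_pos_eq, Hx, Hy by assumption.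
    now destruct z.
  - assert (y < 0) by nra.
    assert (Hc := acos_bound_lt x ltac:(nra)).
    split; [lra|].
    rewrite cos_neg, sin_neg, cos_acos, Hs, Rabs_left, Ropp_involutive, Hx, Hy
      by assumption.
    now destruct z.
Qed.

Definition sector (theta0 r : R) (z : C) : Prop :=
  Cmod z > r /\ Rabs (Carg z) < theta0.

Definition subsector (theta0 theta1 r : R) (z : C) : Prop :=
  sector theta0 r z /\ Rabs (Carg z) <= theta1.

(* Functions on a subset of C are represented by total functions C -> C of which
   only the values on that subset matter.  This predicate is complex
   differentiability at every point and is applied to open sets S only, where it
   is the usual notion of an analytic (holomorphic) function. *)
Definition analytic_on (S : C -> Prop) (f : C -> C) : Prop :=
  forall z : C, S z -> ex_derive (K := C_AbsRing) (V := C_NormedModule) f z.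

Definition little_o (S : C -> Prop) (a b : C -> C) : Prop :=
  forall eps : R, 0 < eps -> exists R0 : R,
    forall z : C, S z -> Cmod z >= R0 -> Cmod (a z) <= eps * Cmod (b z).

Definition asymptotic_sequence (S : C -> Prop) (g : nat -> C -> C) : Prop :=
  forall n : nat, little_o S (g (n + 1)%nat) (g n).

(* f ~ sum_n fs n, {g n}, as z -> infinity in S; [sum_n u N] is the sum of u n
   over 0 <= n <= N. *)
Definition asymptotic_expansion (S : C -> Prop) (f : C -> C)
    (fs : nat -> C -> C) (g : nat -> C -> C) : Prop :=
  forall N : nat,
    little_o S (fun z => (f z - sum_n (fun n => fs n z) N)%C) (g N).

Definition on_circle (z : C) (rho : R) (xi : C) : Prop := Cmod (xi - z)%C = rho.

(* Integral with respect to arc length |dxi| over the circle |xi - z| = rho,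
   in the parametrization xi = z + rho e^{it}, for which |dxi| = rho dt. *)
Definition circle_arclength_int (h : C -> R) (z : C) (rho : R) : R :=
  RInt (fun t : R => h (z + rho * (cos t, sin t))%C * rho) 0 (2 * PI).

Definition GTF (theta0 theta1 r : R) (g : C -> C) : Prop :=
  analytic_on (sector theta0 r) g /\
  exists K R1 : R, 0 < K /\ R1 > r /\
    forall z : C, subsector theta0 theta1 r z -> Cmod z >= R1 ->
      exists rho : R, 0 < rho <= Cmod z / 2 /\
        (forall xi : C, on_circle z rho xi -> sector theta0 r xi) /\
        circle_arclength_int (fun xi => Cmod (g xi) / Cmod (xi - z)%C ^ 2) z rho
          <= K * Cmod (C_derive g z).

Definition GAS (theta0 theta1 r : R) (g : nat -> C -> C) : Prop :=
  asymptotic_sequence (sector theta0 r) g /\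
  forall n : nat, GTF theta0 theta1 r (g n).

(* Main.v *)
(* If [|h| <= eta |g|] on a circle of centre [z] and radius [rho] in the sector,
   then Cauchy's formula gives
   [2 PI |h'(z)| <= int |h| / |xi - z|^2 |dxi| <= eta int |g| / |xi - z|^2 |dxi|],
   and the right-hand side is at most [eta K |g'(z)|] since [g] is a good test
   function; so [h = o(g)] in the sector implies [h' = o(g')] in the subsector.
   The circle stays at distance at least [|z| / 2] from 0, hence goes to infinity
   with [z], and the disc it bounds lies in the sector.  Cauchy's formula is
   obtained without continuity of [h'], by Goursat's bisection on rectangles in
   the polar coordinates [xi = z + s e^{it}]: the integral over [0 <= t <= 2 PI]
   of [Re (h(z + s e^{it}) e^{-it}) / s] is independent of [s] and tends to
   [2 PI Re (h'(z))] as [s] tends to 0. *)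
Require Import Defs.
From Stdlib Require Import Reals Lra.
From Coquelicot Require Import Coquelicot.
Open Scope R_scope.

(** * Differentiability in two real variables and an integral estimate *)

Lemma complex_expansion (h : C -> C) (z l : C)
    (Hh : is_derive (K := C_AbsRing) (V := C_NormedModule) h z l) (eps : R) :
  0 < eps -> exists d, 0 < d /\ forall w : C, Cmod (w - z)%C < d ->
    Cmod (h w - h z - (w - z) * l)%C <= eps * Cmod (w - z)%C.
Proof.
  intros He.
  destruct Hh as [_ Hd].
  destruct (Hd z (fun P HP => HP) (mkposreal eps He)) as [d Hw].
  exists d; split; [apply cond_pos|].
  intros w Hwz; exact (Hw w Hwz).
Qed.

Lemma differentiable_pt_lim_mult (p q : R -> R -> R) (x y px py qx qy : R) :
  differentiable_pt_lim p x y px py ->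
  differentiable_pt_lim q x y qx qy ->
  differentiable_pt_lim (fun u v => p u v * q u v) x y
    (q x y * px + p x y * qx) (q x y * py + p x y * qy).
Proof.
  intros Hp Hq.
  apply (differentiable_pt_lim_comp Rmult); try assumption.
  (* A product differs from its linear part exactly by the product of the two increments, so [eps]
     itself serves as radius. *)
  intros eps; exists eps; intros u v Hu Hv.
  replace (u * v - p x y * q x y - _) with ((u - p x y) * (v - q x y)) by ring.
  rewrite Rabs_mult.
  apply Rmult_le_compat; try apply Rabs_pos; [now apply Rlt_le | apply Rmax_r].
Qed.

Lemma differentiable_pt_lim_plus (p q : R -> R -> R) (x y px py qx qy : R) :
  differentiable_pt_lim p x y px py ->
  differentiable_pt_lim q x y qx qy ->
  differentiable_pt_lim (fun u v => p u v + q u v) x y (px + qx) (py + qy).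
Proof.
  intros Hp Hq.
  replace (px + qx) with (1 * px + 1 * qx) by ring.
  replace (py + qy) with (1 * py + 1 * qy) by ring.
  apply (differentiable_pt_lim_comp Rplus); try assumption.
  intros eps; exists eps; intros u v _ _.
  replace (u + v - _ - _) with 0 by ring.
  rewrite Rabs_R0.
  apply Rmult_le_pos; [apply Rlt_le, cond_pos|].
  eapply Rle_trans; [apply Rabs_pos | apply Rmax_l].
Qed.

Lemma differentiable_pt_lim_fst (p : R -> R) (x y l : R) :
  is_derive p x l -> differentiable_pt_lim (fun u _ => p u) x y l 0.
Proof.
  now intros Hp; apply differentiable_pt_lim_proj1_0, is_derive_Reals.
Qed.

Lemma differentiable_pt_lim_snd (p : R -> R) (x y l : R) :
  is_derive p y l -> differentiable_pt_lim (fun _ v => p v) x y 0 l.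
Proof.
  intros Hp eps.
  apply is_derive_Reals in Hp.
  destruct (differentiable_pt_lim_proj1_0 p y x l Hp eps) as [d Hd].
  exists d; intros u v Hu Hv.
  rewrite Rmax_comm.
  replace (0 * (u - x) + l * (v - y)) with (l * (v - y) + 0 * (u - x)) by ring.
  now apply Hd.
Qed.

Lemma differentiable_continuous_fst (p : R -> R -> R) (x y px py : R) :
  differentiable_pt_lim p x y px py -> continuous (fun u => p u y) x.
Proof.
  intros Hp; apply (ex_derive_continuous (K := R_AbsRing) (V := R_NormedModule)).
  exists px; apply is_derive_Reals.
  replace px with (px * 1 + py * 0) by ring.
  apply (derivable_pt_lim_comp_2d p (fun u => u) (fun _ => y)); trivial.
  - apply derivable_pt_lim_id.
  - apply derivable_pt_lim_const.
Qed.

Lemma differentiable_continuous_snd (p : R -> R -> R) (x y px py : R) :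
  differentiable_pt_lim p x y px py -> continuous (fun v => p x v) y.
Proof.
  intros Hp; apply (ex_derive_continuous (K := R_AbsRing) (V := R_NormedModule)).
  exists py; apply is_derive_Reals.
  replace py with (px * 0 + py * 1) by ring.
  apply (derivable_pt_lim_comp_2d p (fun _ => x) (fun v => v)); trivial.
  - apply derivable_pt_lim_const.
  - apply derivable_pt_lim_id.
Qed.

Lemma abs_RInt_near_const (f : R -> R) (a b c M : R) :
  a <= b -> ex_RInt f a b ->
  (forall t, a <= t <= b -> Rabs (f t - c) <= M) ->
  Rabs (RInt f a b - (b - a) * c) <= (b - a) * M.
Proof.
  intros Hab Hf HM.
  replace (RInt f a b - (b - a) * c) with (RInt (fun t => minus (f t) c) a b).
  - apply abs_RInt_le_const; trivial.
    apply (ex_RInt_minus f (fun _ => c)); [trivial | apply ex_RInt_const].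
  - rewrite (RInt_minus f (fun _ => c)); [| trivial | apply ex_RInt_const].
    now rewrite RInt_const.
Qed.

(** * Fluxes of divergence-free fields through rectangles *)

Section Rectangle.

Variables P Q : R -> R -> R.

(** Outward flux of the field [(P, Q)] through the boundary, i.e. the counterclockwise integral of
    [P dy - Q dx]. *)
Definition flux (x0 x1 y0 y1 : R) : R :=
  RInt (P x1) y0 y1 - RInt (P x0) y0 y1
  + (RInt (fun x => Q x y1) x0 x1 - RInt (fun x => Q x y0) x0 x1).

(** Zero divergence at a single point: sharing [a] encodes [dP/dx + dQ/dy = 0], and no continuity of
    the partial derivatives is asked for. *)
Definition solenoidal_at (x y : R) : Prop :=
  exists a b c, differentiable_pt_lim P x y a b /\
                differentiable_pt_lim Q x y c (- a).

Variables X0 X1 Y0 Y1 : R.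
Hypothesis HPQ : forall x y, X0 <= x <= X1 -> Y0 <= y <= Y1 -> solenoidal_at x y.

Lemma ex_RInt_vert (x y0 y1 : R) :
  X0 <= x <= X1 -> Y0 <= y0 -> y0 <= y1 -> y1 <= Y1 -> ex_RInt (P x) y0 y1.
Proof.
  intros Hx H0 H1 H2.
  apply (ex_RInt_continuous (V := R_CompleteNormedModule)); intros y Hy.
  rewrite Rmin_left, Rmax_right in Hy by assumption.
  destruct (HPQ x y) as (a & b & c & HP & _); [lra | lra |].
  exact (differentiable_continuous_snd _ _ _ _ _ HP).
Qed.

Lemma ex_RInt_horiz (y x0 x1 : R) :
  Y0 <= y <= Y1 -> X0 <= x0 -> x0 <= x1 -> x1 <= X1 ->
  ex_RInt (fun x => Q x y) x0 x1.
Proof.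
  intros Hy H0 H1 H2.
  apply (ex_RInt_continuous (V := R_CompleteNormedModule)); intros x Hx.
  rewrite Rmin_left, Rmax_right in Hx by assumption.
  destruct (HPQ x y) as (a & b & c & _ & HQ); [lra | lra |].
  exact (differentiable_continuous_fst _ _ _ _ _ HQ).
Qed.

(** The four inner half-sides each bound two cells and cancel, being crossed in opposite
    directions. *)
Lemma flux_split (x0 x1 x2 y0 y1 y2 : R) :
  X0 <= x0 -> x0 <= x1 -> x1 <= x2 -> x2 <= X1 ->
  Y0 <= y0 -> y0 <= y1 -> y1 <= y2 -> y2 <= Y1 ->
  flux x0 x2 y0 y2 = flux x0 x1 y0 y1 + flux x1 x2 y0 y1
                     + flux x0 x1 y1 y2 + flux x1 x2 y1 y2.
Proof.
  intros Hx0 Hx01 Hx12 Hx2 Hy0 Hy01 Hy12 Hy2.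
  assert (HV : forall x, X0 <= x <= X1 ->
    RInt (P x) y0 y2 = RInt (P x) y0 y1 + RInt (P x) y1 y2).
  { intros x Hx; symmetry.
    apply (RInt_Chasles (V := R_CompleteNormedModule)); apply ex_RInt_vert; lra. }
  assert (HH : forall y, Y0 <= y <= Y1 ->
    RInt (fun x => Q x y) x0 x2
    = RInt (fun x => Q x y) x0 x1 + RInt (fun x => Q x y) x1 x2).
  { intros y Hy; symmetry.
    apply (RInt_Chasles (V := R_CompleteNormedModule)); apply ex_RInt_horiz; lra. }
  unfold flux; rewrite (HV x0), (HV x2), (HH y0), (HH y2) by lra; ring.
Qed.

(** The affine part of the field at [(x, y)] has divergence [a - a = 0], so its contributions in
    [HV] and [HH] cancel. The remainder is at most [eps / 2 * L] on a boundary of length [2 * L]. *)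
Lemma flux_small (x y eps : R) :
  X0 <= x <= X1 -> Y0 <= y <= Y1 -> 0 < eps ->
  exists d, 0 < d /\ forall x0 x1 y0 y1,
    X0 <= x0 -> x0 <= x <= x1 -> x1 <= X1 ->
    Y0 <= y0 -> y0 <= y <= y1 -> y1 <= Y1 ->
    x1 - x0 < d -> y1 - y0 < d ->
    Rabs (flux x0 x1 y0 y1) <= eps * ((x1 - x0) + (y1 - y0)) ^ 2.
Proof.
  intros Hx Hy He.
  destruct (HPQ x y Hx Hy) as (a & b & c & HP & HQ).
  assert (He2 : 0 < eps / 2) by lra.
  destruct (HP (mkposreal _ He2)) as [d1 H1].
  destruct (HQ (mkposreal _ He2)) as [d2 H2].
  exists (Rmin d1 d2); split; [apply Rmin_pos; apply cond_pos|].
  intros x0 x1 y0 y1 Hx0 Hx01 Hx1 Hy0 Hy01 Hy1 Hdx Hdy.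
  assert (Hd1 := Rmin_l d1 d2); assert (Hd2 := Rmin_r d1 d2).
  set (L := (x1 - x0) + (y1 - y0)).
  assert (Hclose : forall u v, x0 <= u <= x1 -> y0 <= v <= y1 ->
    Rabs (P u v - P x y - (a * (u - x) + b * (v - y))) <= eps / 2 * L /\
    Rabs (Q u v - Q x y - (c * (u - x) + - a * (v - y))) <= eps / 2 * L).
  { intros u v Hu Hv.
    assert (Hux : Rabs (u - x) <= x1 - x0) by (apply Rabs_le; lra).
    assert (Hvy : Rabs (v - y) <= y1 - y0) by (apply Rabs_le; lra).
    assert (HM : Rmax (Rabs (u - x)) (Rabs (v - y)) <= L)
      by (unfold L; apply Rmax_lub; lra).
    split.
    - eapply Rle_trans; [apply H1; lra|].
      apply Rmult_le_compat_l; simpl; lra.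
    - eapply Rle_trans; [apply H2; lra|].
      apply Rmult_le_compat_l; simpl; lra. }
  assert (HexV : forall u, x0 <= u <= x1 -> ex_RInt (P u) y0 y1)
    by (intros; apply ex_RInt_vert; lra).
  assert (HexH : forall v, y0 <= v <= y1 -> ex_RInt (fun u => Q u v) x0 x1)
    by (intros; apply ex_RInt_horiz; lra).
  assert (HV : Rabs (RInt (P x1) y0 y1 - RInt (P x0) y0 y1
                     - (y1 - y0) * (a * (x1 - x0))) <= (y1 - y0) * (eps * L)).
  { replace (RInt (P x1) y0 y1 - RInt (P x0) y0 y1)
      with (RInt (fun v => minus (P x1 v) (P x0 v)) y0 y1)
      by (apply (RInt_minus (P x1) (P x0)); apply HexV; lra).
    apply abs_RInt_near_const; [lra | |].
    - apply (ex_RInt_minus (P x1) (P x0)); apply HexV; lra.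
    - intros v Hv.
      destruct (Hclose x1 v ltac:(lra) Hv) as [Ha _].
      destruct (Hclose x0 v ltac:(lra) Hv) as [Hb _].
      apply Rabs_le_between in Ha; apply Rabs_le_between in Hb.
      unfold minus, plus, opp; simpl; apply Rabs_le; lra. }
  assert (HH : Rabs (RInt (fun u => Q u y1) x0 x1 - RInt (fun u => Q u y0) x0 x1
                     - (x1 - x0) * (- a * (y1 - y0))) <= (x1 - x0) * (eps * L)).
  { replace (RInt (fun u => Q u y1) x0 x1 - RInt (fun u => Q u y0) x0 x1)
      with (RInt (fun u => minus (Q u y1) (Q u y0)) x0 x1)
      by (apply (RInt_minus (fun u => Q u y1) (fun u => Q u y0)); apply HexH; lra).
    apply abs_RInt_near_const; [lra | |].
    - apply (ex_RInt_minus (fun u => Q u y1) (fun u => Q u y0)); apply HexH; lra.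
    - intros u Hu.
      destruct (Hclose u y1 Hu ltac:(lra)) as [_ Ha].
      destruct (Hclose u y0 Hu ltac:(lra)) as [_ Hb].
      apply Rabs_le_between in Ha; apply Rabs_le_between in Hb.
      unfold minus, plus, opp; simpl; apply Rabs_le; lra. }
  apply Rabs_le_between in HV; apply Rabs_le_between in HH.
  unfold flux; apply Rabs_le.
  replace (eps * L ^ 2) with ((y1 - y0) * (eps * L) + (x1 - x0) * (eps * L))
    by (unfold L; ring).
  lra.
Qed.


(** * Bisection of the rectangle *)

Lemma nested_intervals (u v : nat -> R) :
  (forall n, u n <= u (S n)) -> (forall n, v (S n) <= v n) ->
  (forall n, u n <= v n) -> exists x, forall n, u n <= x <= v n.
Proof.
  intros Hu Hv Huv.
  assert (Hu' : forall n k, u n <= u (n + k)%nat).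
  { intros n k; induction k as [|k IH]; [rewrite Nat.add_0_r; lra|].
    rewrite Nat.add_succ_r; specialize (Hu (n + k)%nat); lra. }
  assert (Hv' : forall n k, v (n + k)%nat <= v n).
  { intros n k; induction k as [|k IH]; [rewrite Nat.add_0_r; lra|].
    rewrite Nat.add_succ_r; specialize (Hv (n + k)%nat); lra. }
  assert (Hcross : forall n k, u n <= v k).
  { intros n k; eapply Rle_trans; [apply (Hu' n k)|].
    eapply Rle_trans; [apply Huv|]; rewrite Nat.add_comm; apply Hv'. }
  destruct (completeness (fun x => exists n, x = u n)) as [x [Hub Hlub]].
  - exists (v 0%nat); intros y [n ->]; apply Hcross.
  - now exists (u 0%nat), 0%nat.
  - exists x; intros n; split; [apply Hub; now exists n|].
    apply Hlub; intros y [k ->]; apply Hcross.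
Qed.

Hypothesis HX : X0 <= X1.
Hypothesis HY : Y0 <= Y1.

Let dx (k : nat) : R := (X1 - X0) / 2 ^ k.
Let dy (k : nat) : R := (Y1 - Y0) / 2 ^ k.

Definition cell_flux (k : nat) (c : R * R) : R :=
  Rabs (flux (fst c) (fst c + dx k) (snd c) (snd c + dy k)).

(** Lower-left corner of the cell retained at level [k]. The first quarter with flux at least
    [m / 4 ^ k] is kept; the fourth is taken by default, without a test. *)
Fixpoint worst_corner (m : R) (k : nat) : R * R :=
  match k with
  | O => (X0, Y0)
  | S k =>
      let (x, y) := worst_corner m k in
      if Rle_dec (m / 4 ^ S k) (cell_flux (S k) (x, y)) then (x, y)
      else if Rle_dec (m / 4 ^ S k) (cell_flux (S k) (x + dx (S k), y))
      then (x + dx (S k), y)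
      else if Rle_dec (m / 4 ^ S k) (cell_flux (S k) (x, y + dy (S k)))
      then (x, y + dy (S k))
      else (x + dx (S k), y + dy (S k))
  end.

Lemma dx_step (k : nat) : 0 <= dx k /\ dx k = 2 * dx (S k).
Proof.
  unfold dx; assert (H := pow_lt 2 k ltac:(lra)).
  split; [apply Rdiv_le_0_compat; lra | simpl; field; lra].
Qed.

Lemma dy_step (k : nat) : 0 <= dy k /\ dy k = 2 * dy (S k).
Proof.
  unfold dy; assert (H := pow_lt 2 k ltac:(lra)).
  split; [apply Rdiv_le_0_compat; lra | simpl; field; lra].
Qed.

Lemma worst_corner_step (m : R) (k : nat) :
  let c := worst_corner m k in let c' := worst_corner m (S k) in
  (fst c' = fst c \/ fst c' = fst c + dx (S k)) /\
  (snd c' = snd c \/ snd c' = snd c + dy (S k)).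
Proof.
  simpl; destruct (worst_corner m k) as [x y].
  repeat destruct Rle_dec; simpl; auto.
Qed.

Lemma worst_corner_range (m : R) (k : nat) :
  let c := worst_corner m k in
  (X0 <= fst c /\ fst c + dx k <= X1) /\ (Y0 <= snd c /\ snd c + dy k <= Y1).
Proof.
  induction k as [|k IH]; cbv zeta in *.
  - unfold dx, dy; simpl; lra.
  - destruct (worst_corner_step m k) as [Hx Hy]; cbv zeta in Hx, Hy.
    assert (H1 := dx_step k); assert (H2 := dy_step k).
    split; [destruct Hx as [-> | ->] | destruct Hy as [-> | ->]]; lra.
Qed.

(** By the triangle inequality the four quarters cannot all fall short of a quarter of the bound at
    level [k]; if the first three do, the default choice is correct. *)
Lemma worst_corner_flux (m : R) (k : nat) :
  m <= Rabs (flux X0 X1 Y0 Y1) -> m / 4 ^ k <= cell_flux k (worst_corner m k).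
Proof.
  intros Hm; induction k as [|k IH].
  - unfold cell_flux, dx, dy; simpl; unfold Rdiv; rewrite Rinv_1, !Rmult_1_r.
    now replace (X0 + (X1 - X0)) with X1 by ring;
      replace (Y0 + (Y1 - Y0)) with Y1 by ring.
  - assert (Hr := worst_corner_range m k); cbv zeta in Hr.
    assert (Hx := dx_step k); assert (Hy := dy_step k).
    assert (H4 := pow_lt 4 k ltac:(lra)).
    assert (Hq : m / 4 ^ k = 4 * (m / 4 ^ S k)) by (simpl; field; lra).
    cbn [worst_corner]; destruct (worst_corner m k) as [x y]; simpl fst in *;
      simpl snd in *.
    destruct Rle_dec as [|N1]; [trivial|].
    destruct Rle_dec as [|N2]; [trivial|].
    destruct Rle_dec as [|N3]; [trivial|].
    unfold cell_flux in *; simpl fst in *; simpl snd in *.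
    destruct Hx as [Hx0 Hx]; destruct Hy as [Hy0 Hy].
    rewrite (flux_split x (x + dx (S k)) (x + dx k) y (y + dy (S k)) (y + dy k))
      in IH by lra.
    replace (x + dx k) with (x + dx (S k) + dx (S k)) in IH by lra.
    replace (y + dy k) with (y + dy (S k) + dy (S k)) in IH by lra.
    set (A := flux x (x + dx (S k)) y (y + dy (S k))) in *.
    set (B := flux (x + dx (S k)) (x + dx (S k) + dx (S k)) y (y + dy (S k))) in *.
    set (D := flux x (x + dx (S k)) (y + dy (S k)) (y + dy (S k) + dy (S k))) in *.
    set (E := flux (x + dx (S k)) _ (y + dy (S k)) _) in *.
    assert (T1 := Rabs_triang (A + B + D) E).
    assert (T2 := Rabs_triang (A + B) D).
    assert (T3 := Rabs_triang A B).
    lra.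
Qed.

(* Goursat's bisection argument: a rectangle of nonzero flux would contain
   arbitrarily small ones whose flux is proportional to their area, which
   differentiability at the limit point forbids. *)
Lemma flux_zero : flux X0 X1 Y0 Y1 = 0.
Proof.
  destruct (Req_dec (flux X0 X1 Y0 Y1) 0) as [|Hn]; [trivial | exfalso].
  set (m := Rabs (flux X0 X1 Y0 Y1)).
  assert (Hm : 0 < m) by now apply Rabs_pos_lt.
  destruct (nested_intervals (fun k => fst (worst_corner m k))
              (fun k => fst (worst_corner m k) + dx k)) as [x Hx];
    [| | intros k; assert (H := dx_step k); lra |].
  1, 2 : intros k; assert (H := dx_step k); assert (H' := dx_step (S k));
    destruct (worst_corner_step m k) as [[-> | ->] _]; lra.
  destruct (nested_intervals (fun k => snd (worst_corner m k))
              (fun k => snd (worst_corner m k) + dy k)) as [y Hy];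
    [| | intros k; assert (H := dy_step k); lra |].
  1, 2 : intros k; assert (H := dy_step k); assert (H' := dy_step (S k));
    destruct (worst_corner_step m k) as [_ [-> | ->]]; lra.
  set (s := (X1 - X0) + (Y1 - Y0)).
  assert (Hs : 0 <= s ^ 2) by apply pow2_ge_0.
  (* With this tolerance [eps * s ^ 2 < m], which will contradict the lower bound; the [+ 1] covers
     a rectangle reduced to a point, where [s = 0]. *)
  assert (He : 0 < m / (2 * (s ^ 2 + 1))) by (apply Rdiv_lt_0_compat; lra).
  assert (Hr0 := worst_corner_range m 0); cbv zeta in Hr0.
  destruct (flux_small x y _
    ltac:(specialize (Hx 0%nat); lra) ltac:(specialize (Hy 0%nat); lra) He)
    as [d [Hd Hsmall]].
  assert (Hlim : is_lim_seq (fun k => s * (/ 2) ^ k) 0).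
  { replace (Finite 0) with (Rbar_mult s 0) by (simpl; f_equal; ring).
    apply is_lim_seq_scal_l, is_lim_seq_geom; rewrite Rabs_pos_eq; lra. }
  apply is_lim_seq_spec in Hlim.
  destruct (Hlim (mkposreal d Hd)) as [k Hk].
  specialize (Hk k (le_n k)); simpl in Hk; rewrite Rminus_0_r in Hk.
  assert (H2 := pow_lt 2 k ltac:(lra)).
  assert (Hsk : s * (/ 2) ^ k = dx k + dy k)
    by (rewrite pow_inv; unfold s, dx, dy; field; lra).
  rewrite Hsk in Hk; apply Rabs_lt_between in Hk.
  assert (Hr := worst_corner_range m k); cbv zeta in Hr.
  assert (Hdx := dx_step k); assert (Hdy := dy_step k).
  specialize (Hx k); specialize (Hy k).
  assert (Hf := worst_corner_flux m k (Rle_refl _)); unfold cell_flux in Hf.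
  set (c := worst_corner m k) in *.
  assert (Hup := Hsmall (fst c) (fst c + dx k) (snd c) (snd c + dy k)
    ltac:(lra) ltac:(lra) ltac:(lra) ltac:(lra) ltac:(lra) ltac:(lra)
    ltac:(lra) ltac:(lra)).
  replace (fst c + dx k - fst c + (snd c + dy k - snd c)) with (s * (/ 2) ^ k)
    in Hup by lra.
  assert (Hle := Rle_trans _ _ _ Hf Hup).
  (* The squared half-perimeter of the cell scales by [/ 4 ^ k], exactly like the lower bound; the
     factor left over is below 1. *)
  replace (m / (2 * (s ^ 2 + 1)) * (s * (/ 2) ^ k) ^ 2)
    with (m / 4 ^ k * (s ^ 2 / (2 * (s ^ 2 + 1)))) in Hle.
  - assert (Hpos : 0 < m / 4 ^ k)
      by (apply Rdiv_lt_0_compat; [trivial | apply pow_lt; lra]).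
    assert (Hfrac : s ^ 2 / (2 * (s ^ 2 + 1)) < 1)
      by (apply Rlt_div_l; lra).
    nra.
  - replace 4 with (2 ^ 2) by ring.
    rewrite pow_inv, <- pow_mult, Nat.mul_comm, pow_mult.
    field; split; lra.
Qed.

End Rectangle.

(** * Cauchy-Riemann equations and polar coordinates *)

Lemma sin_cos_sqr_sum (t : R) : sin t * sin t + cos t * cos t = 1.
Proof. exact (sin2_cos2 t). Qed.

Lemma Cmod_sqr (z : C) : Cmod z * Cmod z = Re z * Re z + Im z * Im z.
Proof. generalize (Cmod2_alt z); simpl; lra. Qed.

Lemma Rabs_Re_Im_le_Cmod (z : C) : Rabs (Re z) <= Cmod z /\ Rabs (Im z) <= Cmod z.
Proof.
  assert (H := Rmax_Cmod z).
  split; eapply Rle_trans; [apply Rmax_l | apply H | apply Rmax_r | apply H].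
Qed.

(** Multiplication by [(p, q)] is the real matrix with rows [(p, - q)] and [(q, p)], and the modulus
    of the complex remainder dominates both its components. *)
Lemma cauchy_riemann (h : C -> C) (x y p q : R) :
  is_derive (K := C_AbsRing) (V := C_NormedModule) h (x, y) (p, q) ->
  differentiable_pt_lim (fun u v => Re (h (u, v))) x y p (- q) /\
  differentiable_pt_lim (fun u v => Im (h (u, v))) x y q p.
Proof.
  intros Hh.
  assert (Hexp : forall eps : posreal, locally_2d (fun u v =>
    Cmod (h (u, v) - h (x, y) - ((u, v) - (x, y)) * (p, q))%C
      <= eps * Rmax (Rabs (u - x)) (Rabs (v - y))) x y).
  { intros eps; assert (He := cond_pos eps).
    (* Halving both [eps] and the radius pays for the factor 2 between [Cmod] and the max norm. *)
    destruct (complex_expansion h _ _ Hh (eps / 2) ltac:(lra)) as [d [Hd Hw]].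
    assert (Hd2 : 0 < d / 2) by lra.
    exists (mkposreal _ Hd2); simpl; intros u v Hu Hv.
    assert (HC : Cmod ((u, v) - (x, y))%C
                 <= 2 * Rmax (Rabs (u - x)) (Rabs (v - y))).
    { eapply Rle_trans; [apply Cmod_2Rmax|].
      apply Rmult_le_compat_r.
      - eapply Rle_trans; [apply Rabs_pos | apply Rmax_l].
      - rewrite <- (sqrt_square 2) at 2 by lra; apply sqrt_le_1_alt; lra. }
    assert (HM : Rmax (Rabs (u - x)) (Rabs (v - y)) < d / 2)
      by now apply Rmax_lub_lt.
    eapply Rle_trans; [apply Hw; lra|].
    nra. }
  split; intros eps; destruct (Hexp eps) as [d Hd]; exists d; intros u v Hu Hv;
    (eapply Rle_trans; [| apply (Hd u v Hu Hv)]).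
  - eapply Rle_trans; [| apply (proj1 (Rabs_Re_Im_le_Cmod _))].
    apply Req_le; f_equal; unfold Re; simpl; ring.
  - eapply Rle_trans; [| apply (proj2 (Rabs_Re_Im_le_Cmod _))].
    apply Req_le; f_equal; unfold Im; simpl; ring.
Qed.

Definition polar (z : C) (s t : R) : C :=
  (Re z + s * cos t, Im z + s * sin t).

Lemma polar_eq (z : C) (s t : R) : polar z s t = (z + s * (cos t, sin t))%C.
Proof.
  unfold polar; destruct z; apply injective_projections; simpl; ring.
Qed.

Lemma Cmod_polar (z : C) (s t : R) : 0 <= s -> Cmod (polar z s t - z)%C = s.
Proof.
  intros Hs; rewrite <- (sqrt_Rsqr s) at 2 by trivial; unfold Cmod; f_equal.
  unfold Rsqr; transitivity (s * s * (sin t * sin t + cos t * cos t)).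
  - unfold polar, Re, Im; simpl; ring.
  - rewrite sin_cos_sqr_sum; ring.
Qed.

(* Real and imaginary parts of [h (z + s e^{it}) e^{-it}]. *)
Definition rotated_re (h : C -> C) (z : C) (s t : R) : R :=
  Re (h (polar z s t)) * cos t + Im (h (polar z s t)) * sin t.

Definition rotated_im (h : C -> C) (z : C) (s t : R) : R :=
  Im (h (polar z s t)) * cos t - Re (h (polar z s t)) * sin t.

(** The squares of [rotated_re] and [rotated_im] add up to the squared modulus, rotation being an
    isometry. *)
Lemma rotated_re_le (h : C -> C) (z : C) (s t : R) :
  rotated_re h z s t <= Cmod (h (polar z s t)).
Proof.
  unfold rotated_re; set (w := h _).
  assert (H := Cmod_sqr w); assert (H1 := sin_cos_sqr_sum t); assert (H0 := Cmod_ge_0 w).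
  assert (0 <= Rsqr (Im w * cos t - Re w * sin t)) by apply Rle_0_sqr.
  apply Rsqr_incr_0_var; [unfold Rsqr in * | trivial].
  nra.
Qed.

(* The two fields are the coefficients of [Re (h e^{-it} (dt / s - i ds / s^2))],
   i.e. of the closed form [Im (h(xi) / (xi - z)^2 dxi)] in polar coordinates. *)
Lemma polar_solenoidal (h : C -> C) (z : C) (s t : R) :
  0 < s ->
  ex_derive (K := C_AbsRing) (V := C_NormedModule) h (polar z s t) ->
  solenoidal_at (fun u v => rotated_re h z u v * / u)
                (fun u v => - rotated_im h z u v * / u ^ 2) s t.
Proof.
  intros Hs [[p q] Hh].
  apply cauchy_riemann in Hh as [HU HV].
  set (x := Re z + s * cos t) in *; set (y := Im z + s * sin t) in *.
  assert (Hcos : differentiable_pt_lim (fun _ v => cos v) s t 0 (- sin t))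
    by (apply differentiable_pt_lim_snd; auto_derive; trivial; ring).
  assert (Hsin : differentiable_pt_lim (fun _ v => sin v) s t 0 (cos t))
    by (apply differentiable_pt_lim_snd; auto_derive; trivial; ring).
  assert (Hid : differentiable_pt_lim (fun u _ => u) s t 1 0)
    by (apply differentiable_pt_lim_fst; auto_derive; trivial; ring).
  assert (Hcst : forall c, differentiable_pt_lim (fun _ _ => c) s t 0 0)
    by (intros c; apply (differentiable_pt_lim_fst (fun _ => c)); auto_derive;
        trivial; ring).
  assert (Hinv : differentiable_pt_lim (fun u _ => / u) s t (- / s ^ 2) 0)
    by (apply (differentiable_pt_lim_fst Rinv); auto_derive;
        [lra | simpl; field; lra]).
  assert (Hinv2 : differentiable_pt_lim (fun u _ => / u ^ 2) s t (- 2 / s ^ 3) 0)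
    by (apply (differentiable_pt_lim_fst (fun u => / u ^ 2)); auto_derive;
        [apply Rgt_not_eq; nra | simpl; field; lra]).
  assert (HX := differentiable_pt_lim_plus _ _ _ _ _ _ _ _ (Hcst (Re z))
                  (differentiable_pt_lim_mult _ _ _ _ _ _ _ _ Hid Hcos)).
  assert (HY := differentiable_pt_lim_plus _ _ _ _ _ _ _ _ (Hcst (Im z))
                  (differentiable_pt_lim_mult _ _ _ _ _ _ _ _ Hid Hsin)).
  assert (HU' := differentiable_pt_lim_comp _ _ _ _ _ _ _ _ _ _ _ HU HX HY).
  assert (HV' := differentiable_pt_lim_comp _ _ _ _ _ _ _ _ _ _ _ HV HX HY).
  assert (HP := differentiable_pt_lim_mult _ _ _ _ _ _ _ _
    (differentiable_pt_lim_plus _ _ _ _ _ _ _ _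
      (differentiable_pt_lim_mult _ _ _ _ _ _ _ _ HU' Hcos)
      (differentiable_pt_lim_mult _ _ _ _ _ _ _ _ HV' Hsin)) Hinv).
  (* The minus sign enters as a constant factor [- 1], so that the product rule covers it; the form
     with [- rotated_im] is restored at the end. *)
  assert (HQ := differentiable_pt_lim_mult _ _ _ _ _ _ _ _
    (differentiable_pt_lim_plus _ _ _ _ _ _ _ _
      (differentiable_pt_lim_mult _ _ _ _ _ _ _ _ HU' Hsin)
      (differentiable_pt_lim_mult _ _ _ _ _ _ _ _ (Hcst (- 1))
        (differentiable_pt_lim_mult _ _ _ _ _ _ _ _ HV' Hcos))) Hinv2).
  cbv beta in HP, HQ; fold x y in HP, HQ.
  (* The partial derivatives are read off the types of [HP] and [HQ]. The Cauchy-Riemann relations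
     are built into [HU] and [HV], so [field] suffices to see the divergence vanish. *)
  match type of HP with differentiable_pt_lim _ _ _ ?a ?b =>
    match type of HQ with differentiable_pt_lim _ _ _ ?c ?d =>
      exists a, b, c; split; [exact HP|]; replace (- a) with d by (field; lra)
    end end.
  apply (differentiable_pt_lim_ext _ (fun u v => - rotated_im h z u v * / u ^ 2))
    in HQ; [exact HQ|].
  exists (mkposreal 1 Rlt_0_1); intros u v _ _.
  unfold rotated_im, polar; ring.
Qed.

(** * Cauchy's estimate for the derivative at the centre of a disc *)

Lemma RInt_trig_period (a b : R) :
  is_RInt (fun t => a * cos t + b * sin t) 0 (2 * PI) 0.
Proof.
  replace 0 with (minus (a * sin (2 * PI) - b * cos (2 * PI))
                        (a * sin 0 - b * cos 0)) at 2
    by (rewrite sin_2PI, cos_2PI, sin_0, cos_0; unfold minus, plus, opp; simpl; ring).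
  apply (is_RInt_derive (V := R_CompleteNormedModule)
           (fun t => a * sin t - b * cos t)); intros t _.
  - auto_derive; trivial; ring.
  - apply (ex_derive_continuous (K := R_AbsRing) (V := R_NormedModule));
      auto_derive; trivial.
Qed.

Section CauchyEstimate.

Variables (h : C -> C) (z : C) (rho : R).
Hypothesis Hrho : 0 < rho.
Hypothesis Hh : forall xi : C, Cmod (xi - z)%C <= rho ->
  ex_derive (K := C_AbsRing) (V := C_NormedModule) h xi.

Lemma polar_solenoidal_disc (s t : R) : 0 < s <= rho ->
  solenoidal_at (fun u v => rotated_re h z u v * / u)
                (fun u v => - rotated_im h z u v * / u ^ 2) s t.
Proof.
  intros Hs; apply polar_solenoidal; [lra|].
  apply Hh; rewrite Cmod_polar; lra.
Qed.

Lemma ex_RInt_rotated_re (s : R) : 0 < s <= rho ->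
  ex_RInt (fun t => rotated_re h z s t * / s) 0 (2 * PI).
Proof.
  intros Hs.
  (* The rectangle is degenerate: both radial ends are [s]. *)
  apply (ex_RInt_vert _ _ s s 0 (2 * PI)
    (fun u v Hu _ => polar_solenoidal_disc u v ltac:(lra)) s);
    assert (HPI := PI_RGT_0); lra.
Qed.

(** The flux through [[s, rho] x [0, 2 PI]] vanishes, and the sides [t = 0] and [t = 2 PI] cancel by
    periodicity, leaving the two circles. *)
Lemma RInt_rotated_re_const (s : R) : 0 < s <= rho ->
  RInt (fun t => rotated_re h z rho t * / rho) 0 (2 * PI)
  = RInt (fun t => rotated_re h z s t * / s) 0 (2 * PI).
Proof.
  intros Hs; assert (HPI := PI_RGT_0).
  assert (H0 := flux_zero _ _ s rho 0 (2 * PI)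
    (fun u v Hu _ => polar_solenoidal_disc u v ltac:(lra))
    ltac:(lra) ltac:(lra)).
  unfold flux in H0.
  rewrite (RInt_ext (fun x => - rotated_im h z x (2 * PI) * / x ^ 2)
                    (fun x => - rotated_im h z x 0 * / x ^ 2)) in H0.
  - lra.
  - intros u _; unfold rotated_im, polar.
    now rewrite cos_2PI, sin_2PI, cos_0, sin_0.
Qed.

Lemma RInt_rotated_re_near (l : C) (eps : R) :
  is_derive (K := C_AbsRing) (V := C_NormedModule) h z l -> 0 < eps ->
  exists s, 0 < s <= rho /\
    Rabs (RInt (fun t => rotated_re h z s t * / s) 0 (2 * PI) - 2 * PI * Re l)
      <= 2 * PI * eps.
Proof.
  intros Hl He; assert (HPI := PI_RGT_0).
  (* The real and imaginary parts of the remainder are estimated separately, each taking half of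
     [eps]. *)
  destruct (complex_expansion h z l Hl (eps / 2) ltac:(lra)) as [d [Hd Hw]].
  set (s := Rmin rho (d / 2)).
  assert (Hs1 : s <= rho) by apply Rmin_l.
  assert (Hs2 : s <= d / 2) by apply Rmin_r.
  assert (Hs0 : 0 < s) by (apply Rmin_pos; lra).
  exists s; split; [lra|].
  (* [T] is the contribution of the constant term [h z]; its integral over a full period is 0, so it
     may be subtracted. *)
  set (T := fun t => Re (h z) / s * cos t + Im (h z) / s * sin t).
  assert (HT : is_RInt T 0 (2 * PI) 0) by apply RInt_trig_period.
  assert (HR := ex_RInt_rotated_re s ltac:(lra)).
  replace (RInt (fun t => rotated_re h z s t * / s) 0 (2 * PI))
    with (RInt (fun t => minus (rotated_re h z s t * / s) (T t)) 0 (2 * PI)).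
  2: { rewrite (RInt_minus (fun t => rotated_re h z s t * / s) T);
         [| trivial | now exists 0].
       rewrite (is_RInt_unique T 0 (2 * PI) 0 HT).
       unfold minus, plus, opp; simpl; ring. }
  replace (2 * PI * Re l) with ((2 * PI - 0) * Re l) by ring.
  replace (2 * PI * eps) with ((2 * PI - 0) * eps) by ring.
  apply abs_RInt_near_const; [lra | |].
  { apply (ex_RInt_minus (fun t => rotated_re h z s t * / s) T); trivial.
    now exists 0. }
  intros t _.
  specialize (Hw (polar z s t)); rewrite Cmod_polar in Hw by lra.
  specialize (Hw ltac:(lra)).
  destruct (Rabs_Re_Im_le_Cmod (h (polar z s t) - h z - (polar z s t - z) * l)%C)
    as [H1 H2].
  assert (H3 := Rle_trans _ _ _ H1 Hw); assert (H4 := Rle_trans _ _ _ H2 Hw).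
  set (e1 := Re _) in H3; set (e2 := Im _) in H4.
  replace (minus (rotated_re h z s t * / s) (T t) - Re l)
    with ((e1 * cos t + e2 * sin t) / s).
  - unfold Rdiv; rewrite Rabs_mult, Rabs_inv, (Rabs_pos_eq s) by lra.
    apply Rle_div_l; [lra|].
    eapply Rle_trans; [apply Rabs_triang|]; rewrite !Rabs_mult.
    assert (Hc : Rabs (cos t) <= 1) by (apply Rabs_le, COS_bound).
    assert (Hsn : Rabs (sin t) <= 1) by (apply Rabs_le, SIN_bound).
    assert (P1 := Rabs_pos e1); assert (P2 := Rabs_pos e2).
    assert (P3 := Rabs_pos (cos t)); assert (P4 := Rabs_pos (sin t)).
    nra.
  - unfold e1, e2, T, rotated_re, minus, plus, opp; simpl.
    set (A := Re (h (polar z s t))); set (B := Im (h (polar z s t))).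
    change (fst (h (polar z s t))) with A; change (snd (h (polar z s t))) with B.
    unfold Re, Im.
    (* Rotating [s e^{it} l] back by [e^{-it}] yields [Re l] times [sin t * sin t + cos t * cos t];
       the isolated [Re l] is brought to the same shape for [field]. *)
    replace (fst l) with (fst l * (sin t * sin t + cos t * cos t)) at 3
      by (rewrite sin_cos_sqr_sum; ring).
    field; lra.
Qed.

Lemma RInt_rotated_re_eq (l : C) :
  is_derive (K := C_AbsRing) (V := C_NormedModule) h z l ->
  2 * PI * Re l = RInt (fun t => rotated_re h z rho t * / rho) 0 (2 * PI).
Proof.
  intros Hl; assert (HPI := PI_RGT_0).
  apply cond_eq; intros eps He.
  (* Multiplied by [2 * PI] this gives [eps / 2], leaving room for the strict inequality of
     [cond_eq]. *)
  assert (He' : 0 < eps / (4 * PI)) by (apply Rdiv_lt_0_compat; lra).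
  destruct (RInt_rotated_re_near l _ Hl He') as [s [Hs Hle]].
  rewrite (RInt_rotated_re_const s Hs), Rabs_minus_sym.
  replace (2 * PI * (eps / (4 * PI))) with (eps / 2) in Hle by (field; lra).
  lra.
Qed.

End CauchyEstimate.

(** Turns a bound on the real part of a derivative into a bound on its modulus. *)
Lemma unit_rotation (l : C) : exists c : C, Cmod c = 1 /\ (c * l)%C = RtoC (Cmod l).
Proof.
  destruct (Ceq_dec l 0) as [->|Hl].
  - exists 1%C; rewrite Cmod_1, Cmod_0; split; [trivial | ring].
  - assert (Hm : 0 < Cmod l) by now apply Cmod_gt_0.
    assert (H2 := Cmod_sqr l).
    exists (Re l / Cmod l, - Im l / Cmod l); split.
    + unfold Cmod at 1; simpl fst; simpl snd.
      replace (_ + _) with 1; [apply sqrt_1|].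
      replace ((Re l / Cmod l) ^ 2 + (- Im l / Cmod l) ^ 2)
        with ((Re l * Re l + Im l * Im l) / (Cmod l * Cmod l)) by (field; lra).
      rewrite <- H2; field; lra.
    + apply injective_projections; simpl; fold (Re l) (Im l).
      * replace (Re l / Cmod l * Re l - - Im l / Cmod l * Im l)
          with ((Re l * Re l + Im l * Im l) / Cmod l) by (field; lra).
        rewrite <- H2; field; lra.
      * field; lra.
Qed.

(** By the chain rule the real and imaginary parts of [h] are differentiable along the circle, so
    the integrand is continuous. *)
Lemma ex_RInt_Cmod_polar (h : C -> C) (z : C) (s a b : R) :
  (forall t, ex_derive (K := C_AbsRing) (V := C_NormedModule) h (polar z s t)) ->
  ex_RInt (fun t => Cmod (h (polar z s t)) / s) a b.
Proof.
  intros Hh; unfold Rdiv.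
  apply (ex_RInt_ext (fun t => scal (/ s) (Cmod (h (polar z s t))))).
  { intros t _; apply Rmult_comm. }
  apply (ex_RInt_scal (V := R_NormedModule)).
  apply (ex_RInt_continuous (V := R_CompleteNormedModule)); intros t _.
  destruct (Hh t) as [[p q] Hpq].
  apply cauchy_riemann in Hpq as [HU HV].
  assert (HX : derivable_pt_lim (fun v => Re z + s * cos v) t (- s * sin t))
    by (apply is_derive_Reals; auto_derive; trivial; ring).
  assert (HY : derivable_pt_lim (fun v => Im z + s * sin v) t (s * cos t))
    by (apply is_derive_Reals; auto_derive; trivial; ring).
  assert (HcU : continuous (fun v => Re (h (polar z s v))) t).
  { apply (ex_derive_continuous (K := R_AbsRing) (V := R_NormedModule)).
    eexists; apply is_derive_Reals.
    exact (derivable_pt_lim_comp_2d _ _ _ _ _ _ _ _ HU HX HY). }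
  assert (HcV : continuous (fun v => Im (h (polar z s v))) t).
  { apply (ex_derive_continuous (K := R_AbsRing) (V := R_NormedModule)).
    eexists; apply is_derive_Reals.
    exact (derivable_pt_lim_comp_2d _ _ _ _ _ _ _ _ HV HX HY). }
  apply (continuous_ext (fun v => sqrt (plus
    (mult (Re (h (polar z s v))) (Re (h (polar z s v))))
    (mult (Im (h (polar z s v))) (Im (h (polar z s v))))))).
  - intros v; unfold Cmod; f_equal; unfold plus, mult, Re, Im; simpl; ring.
  - apply (continuous_comp _ sqrt); [| apply continuous_sqrt].
    apply (continuous_plus (V := R_NormedModule));
      now apply (continuous_mult (K := R_AbsRing)).
Qed.

(** The integral formula is applied to [c * h], with [c] unimodular and [c h'(z) = |h'(z)|]: taking
    real parts then loses nothing on the left, and on the right [|c h| = |h|]. *)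
Lemma cauchy_derivative_bound (h : C -> C) (z : C) (rho : R) :
  0 < rho ->
  (forall xi : C, Cmod (xi - z)%C <= rho ->
     ex_derive (K := C_AbsRing) (V := C_NormedModule) h xi) ->
  2 * PI * Cmod (C_derive h z)
    <= RInt (fun t => Cmod (h (polar z rho t)) / rho) 0 (2 * PI).
Proof.
  intros Hrho Hh; assert (HPI := PI_RGT_0).
  assert (Hz : is_derive (K := C_AbsRing) (V := C_NormedModule) h z (C_derive h z)).
  { apply (C_derive_correct h z z), Hh.
    unfold Cminus; rewrite Cplus_opp_r, Cmod_0; lra. }
  destruct (unit_rotation (C_derive h z)) as [c [Hc1 Hc]].
  assert (Hscal : forall xi l,
    is_derive (K := C_AbsRing) (V := C_NormedModule) h xi l ->
    is_derive (K := C_AbsRing) (V := C_NormedModule) (fun w => c * h w)%C xi (c * l)%C).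
  { intros xi l Hl.
    eapply (filterdiff_ext_lin (K := C_AbsRing) (V := C_NormedModule)).
    - exact (filterdiff_scal_r_fct (K := C_AbsRing)
        (U := AbsRing_NormedModule C_AbsRing) (V := C_NormedModule)
        c h _ Cmult_comm Hl).
    - intros w; change (c * (w * l) = w * (c * l))%C; ring. }
  assert (Hch : forall xi : C, Cmod (xi - z)%C <= rho ->
    ex_derive (K := C_AbsRing) (V := C_NormedModule) (fun w => c * h w)%C xi).
  { intros xi Hxi; destruct (Hh xi Hxi) as [l Hl].
    exists (c * l)%C; now apply Hscal. }
  assert (Heq := RInt_rotated_re_eq _ _ _ Hrho Hch _ (Hscal _ _ Hz)).
  rewrite Hc in Heq; simpl Re in Heq; rewrite Heq.
  apply RInt_le; [lra | apply (ex_RInt_rotated_re _ z rho Hch); lra | |].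
  - apply ex_RInt_Cmod_polar; intros t.
    apply Hh; rewrite Cmod_polar; lra.
  - intros t _; apply Rmult_le_compat_r; [apply Rlt_le, Rinv_0_lt_compat, Hrho|].
    eapply Rle_trans; [apply rotated_re_le|].
    cbv beta; rewrite Cmod_mult, Hc1; lra.
Qed.

(** * The disc bounded by a circle lying in the sector *)

Lemma Carg_scal (t : R) (xi : C) : 0 < t -> Carg (t * xi)%C = Carg xi.
Proof.
  intros Ht.
  assert (Hm : Cmod (t * xi)%C = t * Cmod xi)
    by (rewrite Cmod_mult, Cmod_R, Rabs_pos_eq; lra).
  assert (Hre : Re (t * xi)%C = t * Re xi) by (unfold Re; simpl; ring).
  assert (Him : Im (t * xi)%C = t * Im xi) by (unfold Im; simpl; ring).
  unfold Carg; rewrite Hm, Hre, Him.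
  replace (t * Re xi / (t * Cmod xi)) with (Re xi / Cmod xi).
  - destruct (Rle_dec 0 (Im xi)) as [H|H], (Rle_dec 0 (t * Im xi)) as [H'|H'];
      trivial; exfalso; [apply H' | apply H].
    + apply Rmult_le_pos; lra.
    + apply (Rmult_le_reg_l t); lra.
  (* [Rinv_mult] also holds at 0, so [xi = 0] is not a separate case. *)
  - unfold Rdiv; rewrite Rinv_mult.
    replace (t * Re xi * (/ t * / Cmod xi)) with (t * / t * (Re xi * / Cmod xi))
      by ring.
    rewrite Rinv_r; lra.
Qed.

Section DiscInSector.

Variables (theta0 r : R) (z : C) (rho : R).
Hypothesis Hrho : 0 < rho <= Cmod z / 2.
Hypothesis Hcirc : forall xi : C, on_circle z rho xi -> sector theta0 r xi.

(** Intermediate value theorem for the distance to [z] along the ray; [Rmin] and [Rmax] let either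
    end be the one inside the disc. *)
Lemma ray_meets_circle (xi : C) (a b : R) :
  a <= b ->
  Rmin (Cmod (a * xi - z)%C) (Cmod (b * xi - z)%C) <= rho ->
  rho <= Rmax (Cmod (a * xi - z)%C) (Cmod (b * xi - z)%C) ->
  exists t : R, a <= t <= b /\ on_circle z rho (t * xi)%C.
Proof.
  intros Hab Hmin Hmax.
  assert (Hsq : forall t : R, Cmod (t * xi - z)%C
    = sqrt ((t * Re xi - Re z) * (t * Re xi - Re z)
            + (t * Im xi - Im z) * (t * Im xi - Im z)))
    by (intros t; unfold Cmod, Re, Im; simpl; f_equal; ring).
  destruct (IVT_gen (fun t : R => Cmod (t * xi - z)%C) a b rho) as [t [Ht Heq]].
  - intros t; apply continuity_pt_filterlim.
    apply (continuous_ext (fun t => sqrt ((t * Re xi - Re z) * (t * Re xi - Re z)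
            + (t * Im xi - Im z) * (t * Im xi - Im z)))); [easy|].
    apply (continuous_comp _ sqrt); [| apply continuous_sqrt].
    apply (ex_derive_continuous (K := R_AbsRing) (V := R_NormedModule));
      auto_derive; trivial.
  - easy.
  - rewrite Rmin_left, Rmax_right in Ht by assumption.
    now exists t.
Qed.

(* Outside the sector, the segment from [xi] to [0] or the ray from [xi] to
   infinity stays outside it; both leave the disc, hence meet the circle. *)
Lemma disc_in_sector (xi : C) : Cmod (xi - z)%C <= rho -> sector theta0 r xi.
Proof.
  intros Hxi.
  assert (H1 : Cmod (1 * xi - z)%C = Cmod (xi - z)%C) by (f_equal; ring).
  assert (H0 : Cmod (0 * xi - z)%C = Cmod z)
    by (rewrite <- (Cmod_opp z); f_equal; ring).
  assert (Htri := Cmod_triangle (z - xi)%C xi).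
  replace (z - xi + xi)%C with z in Htri by ring.
  replace (Cmod (z - xi)%C) with (Cmod (xi - z)%C) in Htri
    by (rewrite <- Cmod_opp; f_equal; ring).
  (* The disc avoids 0, because [rho <= Cmod z / 2]. *)
  assert (Hpos : 0 < Cmod xi) by lra.
  split.
  (* Towards 0 the modulus only decreases, so [xi] inherits the lower bound [r] from the point met
     on the circle. *)
  - destruct (ray_meets_circle xi 0 1) as [t [Ht Hc]]; [lra | | |].
    + rewrite H1; eapply Rle_trans; [apply Rmin_r | trivial].
    + rewrite H0; eapply Rle_trans; [| apply Rmax_l]; lra.
    + destruct (Hcirc _ Hc) as [Hgt _].
      rewrite Cmod_mult, Cmod_R, Rabs_pos_eq in Hgt by lra.
      nra.
  (* Chosen so that [b * xi] has modulus [Cmod xi + Cmod z + rho], hence lies outside the disc; the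
     argument is constant along the ray. *)
  - set (b := 1 + (Cmod z + rho) / Cmod xi).
    assert (Hb : 0 < (Cmod z + rho) / Cmod xi) by (apply Rdiv_lt_0_compat; lra).
    destruct (ray_meets_circle xi 1 b) as [t [Ht Hc]]; [unfold b; lra | | |].
    + rewrite H1; eapply Rle_trans; [apply Rmin_l | trivial].
    + eapply Rle_trans; [| apply Rmax_r].
      assert (Hbt := Cmod_triangle (b * xi - z)%C z).
      replace (b * xi - z + z)%C with (b * xi)%C in Hbt by ring.
      rewrite Cmod_mult, Cmod_R, Rabs_pos_eq in Hbt by (unfold b; lra).
      assert (b * Cmod xi = Cmod xi + Cmod z + rho) by (unfold b; field; lra).
      lra.
    + destruct (Hcirc _ Hc) as [_ Harg].
      now rewrite Carg_scal in Harg by lra.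
Qed.

End DiscInSector.

(** * Differentiation of little-o relations and of asymptotic expansions *)

Lemma little_o_derive (theta0 theta1 r : R) (g h : C -> C) :
  GTF theta0 theta1 r g -> analytic_on (sector theta0 r) h ->
  little_o (sector theta0 r) h g ->
  little_o (subsector theta0 theta1 r) (C_derive h) (C_derive g).
Proof.
  intros [Hg [K [R1 [HK [_ HGTF]]]]] Hh Ho eps He.
  assert (HPI := PI_RGT_0).
  (* Makes [eta * K = 2 * PI * eps], cancelling the constants of Cauchy's estimate and of the good
     test function. *)
  set (eta := eps * (2 * PI) / K).
  assert (Heta : 0 < eta) by (apply Rdiv_lt_0_compat; nra).
  destruct (Ho eta Heta) as [R0 HR0].
  (* Points of the circle have modulus at least [Cmod z / 2], hence the factor 2 before [R0]. *)
  exists (Rmax (2 * R0) R1); intros z Hz Hzl.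
  assert (HM1 := Rmax_l (2 * R0) R1); assert (HM2 := Rmax_r (2 * R0) R1).
  destruct (HGTF z Hz ltac:(lra)) as [rho [Hrho [Hcirc Hint]]].
  assert (Hdisc := disc_in_sector theta0 r z rho Hrho Hcirc).
  assert (Hpol : forall t, Cmod (polar z rho t - z)%C = rho)
    by (intros t; apply Cmod_polar; lra).
  assert (Hex : forall u, analytic_on (sector theta0 r) u ->
    ex_RInt (fun t => Cmod (u (polar z rho t)) / rho) 0 (2 * PI)).
  { intros u Hu; apply ex_RInt_Cmod_polar; intros t; apply Hu, Hdisc.
    rewrite Hpol; lra. }
  assert (Hcauchy := cauchy_derivative_bound h z rho ltac:(lra)
    (fun xi Hxi => Hh xi (Hdisc xi Hxi))).
  assert (Hcmp : RInt (fun t => Cmod (h (polar z rho t)) / rho) 0 (2 * PI)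
    <= RInt (fun t => eta * (Cmod (g (polar z rho t)) / rho)) 0 (2 * PI)).
  { apply RInt_le; [lra | now apply Hex | |].
    - now apply (ex_RInt_scal (V := R_NormedModule)), Hex.
    - intros t _; unfold Rdiv; rewrite <- Rmult_assoc.
      apply Rmult_le_compat_r; [apply Rlt_le, Rinv_0_lt_compat; lra|].
      apply HR0; [apply Hdisc; rewrite Hpol; lra|].
      assert (Htri := Cmod_triangle (z - polar z rho t)%C (polar z rho t)).
      replace (z - polar z rho t + polar z rho t)%C with z in Htri by ring.
      replace (Cmod (z - polar z rho t)%C) with (Cmod (polar z rho t - z)%C) in Htri
        by (rewrite <- Cmod_opp; f_equal; ring).
      rewrite Hpol in Htri.
      lra. }
  replace (RInt (fun t => eta * (Cmod (g (polar z rho t)) / rho)) 0 (2 * PI))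
    with (eta * RInt (fun t => Cmod (g (polar z rho t)) / rho) 0 (2 * PI)) in Hcmp
    by (symmetry; apply (RInt_scal (V := R_CompleteNormedModule)
          (fun t => Cmod (g (polar z rho t)) / rho)); now apply Hex).
  replace (circle_arclength_int _ z rho)
    with (RInt (fun t => Cmod (g (polar z rho t)) / rho) 0 (2 * PI)) in Hint.
  - apply (Rmult_le_reg_l (2 * PI)); [lra|].
    eapply Rle_trans; [exact Hcauchy|]; eapply Rle_trans; [exact Hcmp|].
    eapply Rle_trans; [apply Rmult_le_compat_l; [lra | exact Hint]|].
    apply Req_le; unfold eta; field; lra.
  - unfold circle_arclength_int; apply RInt_ext; intros t _.
    (* On the circle [|xi - z| = rho], and one factor of [rho ^ 2] cancels against the arc-length
       density [rho]. *)
    rewrite <- polar_eq, Hpol.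
    set (w := Cmod _).
    change (w / rho = w / rho ^ 2 * rho); field; lra.
Qed.

Theorem theorem1 (r theta0 theta1 : R) (hr : 0 < r)
    (htheta1 : 0 < theta1) (htheta : theta1 < theta0) (htheta0 : theta0 < PI)
    (g : nat -> C -> C) (hg : GAS theta0 theta1 r g) :
  asymptotic_sequence (subsector theta0 theta1 r) (fun n => C_derive (g n)) /\
  (forall (f : C -> C) (fs : nat -> C -> C),
     analytic_on (sector theta0 r) f ->
     (forall n : nat, analytic_on (sector theta0 r) (fs n)) ->
     asymptotic_expansion (sector theta0 r) f fs g ->
     asymptotic_expansion (subsector theta0 theta1 r)
       (C_derive f) (fun n => C_derive (fs n)) (fun n => C_derive (g n))).
Proof.
  destruct hg as [Hseq Hgtf].
  split.
  - intros n; apply (little_o_derive theta0 theta1 r); trivial.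
    apply Hgtf.
  - intros f fs Hf Hfs Hexp N.
    (* The partial sum is finite, so [rem] may be differentiated term by term; [rem = o(g N)] is the
       hypothesis and [rem' = o((g N)')] the claim. *)
    set (rem := fun z => (f z - sum_n (fun n => fs n z) N)%C).
    assert (Hrem : forall z, sector theta0 r z ->
      is_derive (K := C_AbsRing) (V := C_NormedModule) rem z
        (C_derive f z - sum_n (fun n => C_derive (fs n) z) N)%C).
    { intros z Hz.
      apply (is_derive_minus (V := C_NormedModule) f
               (fun z => sum_n (fun n => fs n z) N)).
      - apply (C_derive_correct f z z), Hf, Hz.
      - apply (is_derive_sum_n (V := C_NormedModule)); intros n _.
        apply (C_derive_correct (fs n) z z), Hfs, Hz. }
    assert (Ho : little_o (subsector theta0 theta1 r) (C_derive rem) (C_derive (g N))).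
    { apply (little_o_derive theta0 theta1 r); [apply Hgtf | | apply Hexp].
      intros z Hz; eexists; now apply Hrem. }
    intros eps He; destruct (Ho eps He) as [R0 HR0]; exists R0; intros z Hz Hzl.
    rewrite <- (is_C_derive_unique _ _ _ (Hrem z (proj1 Hz))).
    now apply HR0.
Qed.
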